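(* Let $p>3$ be a prime. Then $$\sum_{n=0}^{p-1}\frac{6n+1}{(-512)^n}\binom{2n}{n}^3\equiv p\left(\frac{-2}{p}\right)+\frac{p^3}{16}E_{p-3}\left(\frac14\right)\pmod{p^4}.$$
   Context: $\left(\frac{\cdot}{p}\right)$ denotes the Legendre symbol. The Euler polynomials $E_n(x)$ are defined by $\frac{2e^{xt}}{e^t+1}=\sum_{n\ge0}E_n(x)\frac{t^n}{n!}$ ($|t|<\pi$). Congruences between rational numbers with denominators coprime to $p$ are understood in the ring of rationals with denominator prime to $p$. *)

(* Defs.v *)
From mathcomp Require Import all_boot all_order all_algebra.

Set Implicit Arguments.
Unset Strict Implicit.
Unset Printing Implicit Defensive.

Import Order.TTheory GRing.Theory Num.Theory.

Local Open Scope ring_scope.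

(* Meaningful for p prime, where 'F_p is the field Z/pZ. *)
Definition legendre (a : int) (p : nat) : int :=
  if (a%:~R : 'F_p) == 0 then 0
  else if [exists x : 'F_p, x ^+ 2 == a%:~R] then 1 else -1.

(* Formal power series in t over R: f : nat -> R stands for \sum_n f n * t^n. *)
Section PowerSeries.
Variable R : comUnitRingType.
Implicit Types a b c : nat -> R.

Definition ps_mul a b : nat -> R :=
  fun n => \sum_(k < n.+1) a k * b (n - k)%N.

Definition ps_add a b : nat -> R := fun n => a n + b n.

Definition ps_const (r : R) : nat -> R := fun n => if n is 0 then r else 0.

Fixpoint ps_div_seq c a (n : nat) : seq R :=
  if n is m.+1 then
    let q := ps_div_seq c a m in
    rcons q ((c m - \sum_(k < m) q`_k * a (m - k)%N) / a 0%N)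
  else [::].

(* The quotient c / a when a 0 is a unit: see ps_divK. *)
Definition ps_div c a : nat -> R := fun n => (ps_div_seq c a n.+1)`_n.

Lemma size_ps_div_seq c a n : size (ps_div_seq c a n) = n.
Proof. by elim: n => //= n IHn; rewrite size_rcons IHn. Qed.

Lemma nth_ps_div_seq c a n k :
  (k < n)%N -> (ps_div_seq c a n)`_k = ps_div c a k.
Proof.
elim: n => // n IHn; rewrite ltnS leq_eqVlt => /orP[/eqP-> //|lt_kn].
by rewrite /= nth_rcons size_ps_div_seq lt_kn IHn.
Qed.

Lemma ps_divE c a n :
  ps_div c a n =
    (c n - \sum_(k < n) ps_div c a k * a (n - k)%N) / a 0%N.
Proof.
rewrite {1}/ps_div /= nth_rcons size_ps_div_seq ltnn eqxx.
by under eq_bigr => k _ do rewrite nth_ps_div_seq //.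
Qed.

Lemma ps_divK c a :
  a 0%N \is a GRing.unit -> ps_mul (ps_div c a) a =1 c.
Proof.
move=> Ua n; rewrite /ps_mul big_ord_recr /= subnn [X in _ + X * _]ps_divE.
by rewrite divrK // addrC subrK.
Qed.

End PowerSeries.

(* e^(x t), as a power series in t. *)
Definition ps_exp (x : {poly rat}) : nat -> {poly rat} :=
  fun n => n`!%:R^-1 *: x ^+ n.

(* 2 e^(x t) / (e^t + 1) in Q[x][[t]], where x is the indeterminate 'X. *)
Definition euler_gf : nat -> {poly rat} :=
  ps_div (ps_mul (ps_const 2) (ps_exp 'X)) (ps_add (ps_exp 1) (ps_const 1)).

Definition euler_poly (n : nat) : {poly rat} := n`!%:R *: euler_gf n.

Lemma euler_poly_gf :
  ps_mul (fun n => n`!%:R^-1 *: euler_poly n) (ps_add (ps_exp 1) (ps_const 1))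
    =1 ps_mul (ps_const 2) (ps_exp 'X).
Proof.
move=> n.
have U0 : ps_add (ps_exp 1) (ps_const 1) 0%N \is a GRing.unit.
  rewrite /ps_add /ps_exp /= fact0 invr1 scale1r expr0.
  by rewrite -[1]polyC1 -polyCD poly_unitE coefC size_polyC.
rewrite -(ps_divK (ps_mul (ps_const 2) (ps_exp 'X)) U0).
apply: eq_bigr => k _; rewrite /euler_poly scalerA mulVf ?scale1r //.
by rewrite pnatr_eq0 -lt0n fact_gt0.
Qed.

(* The ring of rationals with denominator prime to p. *)
Definition plocal (p : nat) (x : rat) : bool := coprimez p%:Z (denq x).

(* x = y modulo the principal ideal generated by m in that ring. *)
Definition eqmod_plocal (p : nat) (m x y : rat) : Prop :=
  exists2 c : rat, plocal p c & x - y = m * c.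

(* Main.v *)
(** Put S(w) = \sum_(k < p) (6k+1) C(2k,k) (-1/8)^k
      \prod_(i < k) ((2i+1)^2 - w^2) / \prod_(0 < j <= k) (16j^2 - w^2),
    an even function of w; the theorem is about S(0).  A telescoping
    (Wilf-Zeilberger) recurrence relates S(w+4) and S(w).

    At odd w < 2p the sum terminates and the recurrence evaluates it; in particular
    S(p) = p (-2/p) exactly.  Let N(w) be S(w) with its denominators cleared, a
    polynomial over the integers.  Modulo p the recurrence reads
    (w+4) N(w+4) + w N(w) = 0, and iterating it p times, an odd number, forces
    N = 0; so N = p W, and it remains to find the coefficient of w^2 in W
    modulo p.

    Dividing the recurrence by p gives, with L = w^p - w, the equation
    v(w+4) + v(w) = L^2/(w+1) + L^2/(w+3) over F_p for v = w W.  Iterating it p times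
    yields v as an alternating sum, and its coefficient of w^3 is
    - \sum_(j < p) (-1)^j (1+4j)^(p-3), which is - E_(p-3)(1/4) / 16 modulo p because
    E_n(x+1) + E_n(x) = 2 x^n. *)

Require Import Defs.
From mathcomp Require Import all_boot all_order all_algebra.
From mathcomp Require Import finfield.
From mathcomp Require Import ring lra zify.
Import Order.TTheory GRing.Theory Num.Theory.
Local Open Scope ring_scope.

(** * The truncated sum and its shift recurrence *)

Section TruncatedSum.
Variable R : comNzRingType.
Implicit Types (n k m : nat) (w : R).

Definition odd_factors n w : R := \prod_(i < n) ((2 * i + 1)%:R ^+ 2 - w ^+ 2).

Definition den_factors n w : R := \prod_(1 <= j < n) (16 * j%:R ^+ 2 - w ^+ 2).

(* The sum over k < n of (6k+1) C(2k,k) (-1/8)^k odd_factors k w / den_factors k.+1 w,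
   multiplied by 8 ^ (n-1) * den_factors n w. *)
Fixpoint num_sum n w : R :=
  if n is m.+1 then
    8 * (16 * m%:R ^+ 2 - w ^+ 2) * num_sum m w
      + (6 * m + 1)%:R * 'C(2 * m, m)%:R * (-1) ^+ m * odd_factors m w
  else 0.

Lemma num_sumS n w :
  num_sum n.+1 w = 8 * (16 * n%:R ^+ 2 - w ^+ 2) * num_sum n w
    + (6 * n + 1)%:R * 'C(2 * n, n)%:R * (-1) ^+ n * odd_factors n w.
Proof. by []. Qed.

(** The linear factors that [odd_factors k.+2] has in common at w and at w + 4, apart from w + 1 and
    w + 3. *)
Definition cert_factors k w : R :=
  \prod_(i < k) (((2 * i + 1)%:R - w) * ((2 * i + 5)%:R + w)).

Lemma odd_factors_cert k w :
  odd_factors k.+2 w =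
    cert_factors k w * ((2 * k + 1)%:R - w) * ((2 * k + 3)%:R - w)
      * ((w + 1) * (w + 3)).
Proof.
elim: k => [|k IHk].
  by rewrite /odd_factors /cert_factors big_ord0 !big_ord_recr big_ord0 /=; ring.
rewrite /odd_factors big_ord_recr -/(odd_factors _ _) IHk /cert_factors.
by rewrite big_ord_recr /=; ring.
Qed.

Lemma odd_factors_shift k w :
  odd_factors k.+2 (w + 4) =
    cert_factors k w * ((2 * k + 5)%:R + w) * ((2 * k + 7)%:R + w)
      * ((w + 1) * (w + 3)).
Proof.
elim: k => [|k IHk].
  by rewrite /odd_factors /cert_factors big_ord0 !big_ord_recr big_ord0 /=; ring.
rewrite /odd_factors big_ord_recr -/(odd_factors _ _) IHk /cert_factors.
by rewrite big_ord_recr /=; ring.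
Qed.

Lemma mul_central_bin n :
  (n.+1 * 'C(2 * n.+1, n.+1) = 2 * (2 * n + 1) * 'C(2 * n, n))%N.
Proof.
have -> : (2 * n.+1 = (2 * n).+2)%N by lia.
have p3 : ((2 * n).+1 * 'C(2 * n, n) = n.+1 * 'C((2 * n).+1, n.+1))%N.
  exact: mul_bin_diag.
have p4 : ('C((2 * n).+1, n) = 'C((2 * n).+1, n.+1))%N.
  by rewrite -(@bin_sub (2 * n).+1 n); [congr 'C(_, _); lia | lia].
by rewrite binS p4; nia.
Qed.

(** The Wilf-Zeilberger recurrence with denominators cleared. By [den_factors_shift] the multipliers
    on the left are those for which, in terms of S, the left side is proportional to S(w+4)/(w+4) +
    S(w)/w. The right side is the telescoped certificate, checked by induction on k. *)
Lemma num_sum_shift k w :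
  ((4 * k + 4)%:R - w) * num_sum k.+2 (w + 4)
    - ((4 * k + 8)%:R + w) * num_sum k.+2 w =
  (-1) ^+ k.+1 * (k.+2 * 'C(2 * k.+2, k.+2))%:R
    * ((w + 1) * (w + 2) * (w + 3)) * cert_factors k w.
Proof.
elim: k => [|k IHk].
  rewrite /= /odd_factors /cert_factors !big_ord_recr !big_ord0 /=.
  by rewrite (_ : 'C(2 * 0, 0) = 1)%N // (_ : 'C(2 * 1, 1) = 2)%N //
             (_ : 'C(2 * 2, 2) = 6)%N //; ring.
rewrite !(num_sumS k.+2) odd_factors_shift odd_factors_cert.
set n := k.+2 in IHk *.
rewrite mul_central_bin /cert_factors big_ord_recr -/(cert_factors k w) /=.
(* Since 16n^2 - (w+4)^2 = (4k+4-w)(4k+12+w) and 16n^2 - w^2 = (4k+8-w)(4k+8+w) for n = k+2, the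
   left side of the induction hypothesis factors out. *)
have -> : ((4 * k.+1 + 4)%:R - w) *
  (8 * (16 * n%:R ^+ 2 - (w + 4) ^+ 2) * num_sum n (w + 4) +
   (6 * n + 1)%:R * 'C(2 * n, n)%:R * (-1) ^+ n *
   (cert_factors k w * ((2 * k + 5)%:R + w) * ((2 * k + 7)%:R + w) *
    ((w + 1) * (w + 3)))) -
  ((4 * k.+1 + 8)%:R + w) *
  (8 * (16 * n%:R ^+ 2 - w ^+ 2) * num_sum n w +
   (6 * n + 1)%:R * 'C(2 * n, n)%:R * (-1) ^+ n *
   (cert_factors k w * ((2 * k + 1)%:R - w) * ((2 * k + 3)%:R - w) *
    ((w + 1) * (w + 3)))) =
  8 * ((4 * k.+1 + 4)%:R - w) * ((4 * k.+1 + 8)%:R + w) *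
  (((4 * k + 4)%:R - w) * num_sum n (w + 4) - ((4 * k + 8)%:R + w) * num_sum n w)
  + (6 * n + 1)%:R * 'C(2 * n, n)%:R * (-1) ^+ n * cert_factors k w
   * ((w + 1) * (w + 3)) *
   (((4 * k.+1 + 4)%:R - w) * ((2 * k + 5)%:R + w) * ((2 * k + 7)%:R + w)
    - ((4 * k.+1 + 8)%:R + w) * ((2 * k + 1)%:R - w) * ((2 * k + 3)%:R - w)).
  by rewrite /n; ring.
rewrite IHk !natrM /n; move: 'C(_, _)%:R (cert_factors k w) => c f.
by rewrite !exprS; ring.
Qed.

Lemma num_sumN n w : num_sum n (- w) = num_sum n w.
Proof. by elim: n => //= n ->; rewrite /odd_factors sqrrN. Qed.

Lemma den_factorsN n w : den_factors n (- w) = den_factors n w.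
Proof. by rewrite /den_factors sqrrN. Qed.

Lemma den_factorsS n w : (0 < n)%N ->
  den_factors n.+1 w = den_factors n w * (16 * n%:R ^+ 2 - w ^+ 2).
Proof. by move=> n0; rewrite /den_factors big_nat_recr. Qed.

(** Moving w by 4 shifts the index in the factors 4j - w and 4j + w by one, so only boundary factors
    change. *)
Lemma den_factors_shift n w :
  den_factors n.+1 (w + 4) * (((4 * n)%:R - w) * (w + 4)) =
  - den_factors n.+1 w * (((4 * n)%:R + w + 4) * w).
Proof.
elim: n => [|n IHn]; first by rewrite /den_factors !big_geq //; ring.
rewrite !(den_factorsS n.+1) //.
have -> : den_factors n.+1 (w + 4) * (16 * n.+1%:R ^+ 2 - (w + 4) ^+ 2) *
    (((4 * n.+1)%:R - w) * (w + 4)) =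
  den_factors n.+1 (w + 4) * (((4 * n)%:R - w) * (w + 4))
    * (((4 * n.+1)%:R + w + 4) * ((4 * n.+1)%:R - w)).
  by ring.
by rewrite IHn; ring.
Qed.

End TruncatedSum.

(** * Euler polynomials and alternating power sums *)

Section EulerPoly.
Implicit Types (x y : rat) (n k j : nat).

Definition euler_val n x : rat := (euler_poly n).[x].

(** Compares coefficients of t^n in the generating function multiplied by e^t + 1, and scales by
    n!. *)
Lemma euler_val_rec n x :
  \sum_(k < n.+1) 'C(n, k)%:R * euler_val k x + euler_val n x = 2 * x ^+ n.
Proof.
have fact_neq0 m : m`!%:R != 0 :> rat by rewrite pnatr_eq0 -lt0n fact_gt0.
have rhs : (ps_mul (ps_const 2) (ps_exp 'X) n).[x] = 2 * (n`!%:R^-1 * x ^+ n).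
  rewrite /ps_mul big_ord_recl big1 => [|i _]; last first.
    by rewrite /ps_const /= mul0r.
  rewrite addr0 /ps_const /ps_exp /= subn0 hornerM hornerZ hornerXn.
  by rewrite -[2]polyC_natr hornerC.
have exp1 m : (ps_exp 1 m).[x] = m`!%:R^-1 by rewrite /ps_exp expr1n hornerZ hornerC mulr1.
have lhs : (ps_mul (fun m => m`!%:R^-1 *: euler_poly m)
    (ps_add (ps_exp 1) (ps_const 1)) n).[x] =
  n`!%:R^-1 * (\sum_(k < n.+1) 'C(n, k)%:R * euler_val k x + euler_val n x).
  rewrite /ps_mul horner_sum !big_ord_recr /= [RHS]mulrDr
    [X in _ = X + _]mulrDr mulr_sumr -addrA.
  congr (_ + _).
    apply: eq_bigr => k _; rewrite hornerM hornerZ /ps_add hornerD exp1.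
    have -> : ps_const 1 (n - k) = 0 :> {poly rat}.
      by rewrite /ps_const; case: (n - k)%N (subn_gt0 k n) => //; rewrite ltn_ord.
    rewrite horner0 addr0 -(bin_fact (ltnW (ltn_ord k))) -/(euler_val k x) !natrM.
    field; rewrite !fact_neq0 /= pnatr_eq0 -lt0n bin_gt0 ltnW //.
  rewrite binn mul1r hornerM hornerZ /ps_add subnn hornerD exp1 hornerC.
  by rewrite -/(euler_val n x) fact0 invr1; ring.
have /(mulfI _) : n`!%:R^-1 * (\sum_(k < n.+1) 'C(n, k)%:R * euler_val k x
    + euler_val n x) = n`!%:R^-1 * (2 * x ^+ n).
  by rewrite -lhs euler_poly_gf rhs; ring.
by apply; rewrite invr_eq0.
Qed.

Lemma euler_val_shift n x : euler_val n (x + 1) + euler_val n x = 2 * x ^+ n.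
Proof.
(* The addition formula reduces the claim to [euler_val_rec]. It is proved by strong induction: both
   sides satisfy the recursion with right side 2(x+1)^m, which determines the top term. *)
suff e m : euler_val m (x + 1) = \sum_(k < m.+1) 'C(m, k)%:R * euler_val k x.
  by rewrite e euler_val_rec.
elim/ltn_ind: m => m IHm.
pose f k := \sum_(i < k.+1) 'C(k, i)%:R * euler_val i x.
have conv : \sum_(k < m.+1) 'C(m, k)%:R * (f k + euler_val k x) = 2 * (x + 1) ^+ m.
  rewrite [x + 1]addrC exprDn mulr_sumr; apply: eq_bigr => k _.
  by rewrite /f euler_val_rec expr1n mul1r -mulr_natl; ring.
have := euler_val_rec m (x + 1); rewrite -conv -/(f m).
rewrite [in LHS]big_ord_recr [in RHS]big_ord_recr /= binn.
under eq_bigr => k _ do rewrite IHm -/(f k) //.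
under [in RHS]eq_bigr => k _ do rewrite mulrDr.
rewrite big_split /= => e.
have fE : f m = \sum_(k < m) 'C(m, k)%:R * euler_val k x + euler_val m x.
  by rewrite /f big_ord_recr /= binn mul1r.
move: e; set s := \sum_(k < m) _ * f k; lra.
Qed.

Lemma alternating_sum_euler n m x :
  2 * \sum_(j < m) (-1) ^+ j * (x + j%:R) ^+ n =
    euler_val n x - (-1) ^+ m * euler_val n (x + m%:R).
Proof.
elim: m => [|m IHm]; first by rewrite big_ord0 addr0; ring.
rewrite big_ord_recr mulrDr IHm /= exprS.
rewrite (_ : x + m.+1%:R = x + m%:R + 1); last by rewrite -natr1 addrA.
have /(canRL (addrK _)) -> := euler_val_shift n (x + m%:R); ring.
Qed.

End EulerPoly.

(** * Rationals with denominator prime to p *)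

Section PLocal.
Variable p : nat.
Hypothesis p_prime : prime p.
Implicit Types (x y : rat) (z : int).

(** Any denominator prime to p will do, so closure properties need no reduced fractions. *)
Lemma plocalP x :
  reflect (exists2 d : int, coprimez p d & exists z : int, x * d%:~R = z%:~R)
          (plocal p x).
Proof.
apply: (iffP idP) => [px|[d pd [z xd]]].
  by exists (denq x) => //; exists (numq x); rewrite numqE.
have : (denq x %| d * numq x)%Z.
  apply/dvdzP; exists z; apply/eqP; rewrite -(eqr_int rat) !rmorphM /= -xd numqE.
  by apply/eqP; ring.
rewrite Gauss_dvdzl => [dd|]; last first.
  by rewrite coprimezE coprime_sym coprime_num_den.
exact: coprimez_dvdr pd.
Qed.

Lemma plocal_int z : plocal p z%:~R.
Proof. by rewrite /plocal denq_int /coprimez gcdzC gcd1z. Qed.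

Lemma plocalD x y : plocal p x -> plocal p y -> plocal p (x + y).
Proof.
move=> /plocalP[d pd [a xd]] /plocalP[e pe [b ye]]; apply/plocalP.
exists (d * e); first by rewrite coprimezMr pd.
by exists (a * e + b * d); rewrite rmorphD !rmorphM /= -xd -ye; ring.
Qed.

Lemma plocalM x y : plocal p x -> plocal p y -> plocal p (x * y).
Proof.
move=> /plocalP[d pd [a xd]] /plocalP[e pe [b ye]]; apply/plocalP.
exists (d * e); first by rewrite coprimezMr pd.
by exists (a * b); rewrite !rmorphM /= -xd -ye; ring.
Qed.

Lemma plocalN x : plocal p x -> plocal p (- x).
Proof. by rewrite /plocal denqN. Qed.

Lemma plocalX x n : plocal p x -> plocal p (x ^+ n).
Proof.
move=> px; elim: n => [|n IHn]; first exact: (plocal_int 1).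
by rewrite exprS; apply: plocalM.
Qed.

Lemma plocalV z : coprimez p z -> plocal p z%:~R^-1.
Proof.
move=> pz; apply/plocalP; exists z => //; exists 1.
rewrite mulVf // intr_eq0; apply/eqP => z0; move: pz.
by rewrite z0 /coprimez gcdz0 /= => /eqP[p1]; move: p_prime; rewrite p1.
Qed.

Lemma plocal_sum (I : Type) (r : seq I) (P : pred I) (f : I -> rat) :
  (forall i, P i -> plocal p (f i)) -> plocal p (\sum_(i <- r | P i) f i).
Proof.
by move=> pf; apply: (big_ind (plocal p)) => //;
  [exact: (plocal_int 0) | exact: plocalD].
Qed.

Lemma intr_Fp_eq0 z : ((z%:~R : 'F_p) == 0) = (p %| z)%Z.
Proof.
case: z => n; rewrite dvdzE ?NegzE ?abszN ?rmorphN ?oppr_eq0 /=;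
  by rewrite -pmulrn (dvdn_pcharf (pchar_Fp p_prime)).
Qed.

Lemma intr_Fp_eq (a b : int) : (a%:~R : 'F_p) = b%:~R ->
  exists c : int, a = b + p%:Z * c.
Proof.
move/eqP; rewrite -subr_eq0 -rmorphB intr_Fp_eq0 => /dvdzP[c e].
by exists c; rewrite mulrC -e; ring.
Qed.

Hypothesis p_gt2 : (2 < p)%N.

Lemma coprimez_pow2 k : coprimez p (2 ^+ k).
Proof.
rewrite coprimezE abszX /= prime_coprime // Euclid_dvdX // negb_and.
by rewrite dvdn_prime2 // gtn_eqF.
Qed.

Lemma plocal_pow2V k : plocal p (2 ^- k).
Proof. by have := plocalV _ (coprimez_pow2 k); rewrite rmorphXn. Qed.

(** Solved for its top term, the recursion divides only by 2, a unit for odd p. Integrality and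
    congruences then follow by induction on n. *)
Lemma euler_val_eq n x :
  euler_val n x = x ^+ n - 2^-1 * \sum_(k < n) 'C(n, k)%:R * euler_val k x.
Proof.
have := euler_val_rec n x; rewrite big_ord_recr /= binn mul1r.
by set s := \sum_(k < n) _; lra.
Qed.

Lemma plocal_euler n x : plocal p x -> plocal p (euler_val n x).
Proof.
move=> px; elim/ltn_ind: n => n IHn; rewrite euler_val_eq.
apply: plocalD; first exact: plocalX.
apply/plocalN/plocalM; first exact: (plocal_pow2V 1).
apply: plocal_sum => k _; apply: plocalM; last exact: IHn.
exact: (plocal_int (Posz 'C(n, k))).
Qed.

(** The difference quotient with step p obeys the same recursion, with x^n replaced by its own
    difference quotient, which is p-integral. *)
Lemma euler_val_addp n x : plocal p x ->
  exists2 c, plocal p c & euler_val n (x + p%:R) = euler_val n x + p%:R * c.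
Proof.
move=> px; suff: plocal p ((euler_val n (x + p%:R) - euler_val n x) / p%:R).
  move=> pc; exists ((euler_val n (x + p%:R) - euler_val n x) / p%:R) => //.
  by field; rewrite pnatr_eq0 -lt0n prime_gt0.
elim/ltn_ind: n => n IHn; rewrite !(euler_val_eq n).
have p0 : p%:R != 0 :> rat by rewrite pnatr_eq0 -lt0n prime_gt0.
have -> : (x + p%:R) ^+ n = x ^+ n + p%:R * \sum_(i < n) (x + p%:R) ^+ (n.-1 - i) * x ^+ i.
  by have /(canRL (subrK _)) -> := subrXX (x + p%:R) x n; ring.
set s := \sum_(i < n) _ ^+ _ * _; set f := \sum_(k < n) _; set g := \sum_(k < n) _.
have -> : (x ^+ n + p%:R * s - 2^-1 * f - (x ^+ n - 2^-1 * g)) / p%:R =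
    s - 2^-1 * \sum_(k < n) 'C(n, k)%:R * ((euler_val k (x + p%:R) - euler_val k x) / p%:R).
  under eq_bigr => k _ do rewrite mulrA mulrBr.
  by rewrite -mulr_suml sumrB -/f -/g; field.
have pp : plocal p p%:R by exact: (plocal_int p).
apply: plocalD.
  apply: plocal_sum => i _; apply: plocalM; apply: plocalX => //.
  exact: plocalD.
apply/plocalN/plocalM; first exact: (plocal_pow2V 1).
apply: plocal_sum => k _; apply: plocalM; last exact: IHn.
exact: (plocal_int (Posz 'C(n, k))).
Qed.

(* With the alternating sum made integral by the factor 4 ^ n, its value modulo
   p is that of E_n(1/4), since p is odd. *)
Lemma alternating_sum_quarter n :
  exists2 c, plocal p c &
    4 ^+ n * euler_val n (1 / 4) =
      (\sum_(j < p) (-1) ^+ j * (1 + 4 * j%:Z) ^+ n)%:~R + p%:R * c.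
Proof.
have p4 : plocal p (1 / 4) by rewrite mul1r; exact: (plocal_pow2V 2).
have [c pc e] := euler_val_addp n _ p4.
exists (- 2^-1 * 4 ^+ n * c).
  apply: plocalM => //; apply: plocalM; first by apply/plocalN/(plocal_pow2V 1).
  by apply: plocalX; exact: (plocal_int 4).
have odd_p : odd p by case: (even_prime p_prime) p_gt2 => // ->.
have := alternating_sum_euler n p (1 / 4).
rewrite -signr_odd odd_p e => alt.
have -> : (\sum_(j < p) (-1) ^+ j * (1 + 4 * j%:Z) ^+ n)%:~R =
    4 ^+ n * \sum_(j < p) (-1) ^+ j * (1 / 4 + j%:R) ^+ n :> rat.
  rewrite rmorph_sum mulr_sumr; apply: eq_bigr => j _.
  rewrite rmorphM rmorphXn rmorphXn /= mulrCA -exprMn; congr (_ * _ ^+ _).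
  by rewrite rmorphD rmorphM /=; field.
move: alt; set s := \sum_(j < p) _ => alt.
by rewrite (_ : s = euler_val n (1 / 4) + p%:R * c / 2); [field | lra].
Qed.

End PLocal.

(** * Polynomial identities over the field with p elements *)

Section FpPoly.
Variable p : nat.
Hypothesis p_prime : prime p.
Hypothesis p_gt4 : (4 < p)%N.
Local Notation F := 'F_p.

Let p_char : p \in [pchar F]. Proof. exact: pchar_Fp. Qed.

Let pF0 : p%:R = 0 :> F. Proof. exact: pcharf0. Qed.

Let p_odd : odd p.
Proof. by case: (even_prime p_prime) p_gt4 => // ->. Qed.

Let natF_inj : {in [pred i | (i < p)%N] &, injective (fun i => i%:R : F)}.
Proof.
move=> i j; rewrite !inE => ip jp /(congr1 (fun x : F => x : nat)).
by rewrite /= !val_Fp_nat // !modn_small.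
Qed.

Let natF_neq0 n : (0 < n < p)%N -> (n%:R : F) != 0.
Proof. by case/andP=> n0 np; rewrite -(dvdn_pcharf p_char) gtnNdvd. Qed.

Let two0 : (2 : F) != 0. Proof. by apply: natF_neq0; lia. Qed.

Let four0 : (4 : F) != 0. Proof. by apply: natF_neq0; lia. Qed.

Let fermat (c : F) : c ^+ p = c.
Proof. by have := expf_card c; rewrite card_Fp. Qed.

(** The polynomial L of the overview, whose roots are all the elements of the field. *)
Definition all_roots : {poly F} := 'X^p - 'X.

Lemma prod_affine (a b : F) : a != 0 ->
  \prod_(i < p) ('X + (a * i%:R + b)%:P) = all_roots.
Proof.
move=> a0; pose h (i : 'I_p) : F := - (a * i%:R + b).
have h_inj : injective h.
  move=> i j /oppr_inj/addIr/(mulfI a0) e; apply: val_inj.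
  exact: (natF_inj _ _ (ltn_ord i) (ltn_ord j) e).
have h_bij : bijective h by apply: inj_card_bij; rewrite // card_Fp // card_ord.
have := finField_genPoly F; rewrite card_Fp // -/all_roots => ->.
rewrite (reindex h) /=; last exact: onW_bij.
by apply: eq_bigr => i _; rewrite /h polyCN opprK.
Qed.

Lemma all_roots_shift (c : F) : all_roots \Po ('X + c%:P) = all_roots.
Proof.
rewrite /all_roots comp_polyB comp_polyX comp_Xn_poly exprDn_pchar.
  by rewrite -polyC_exp fermat; ring.
by rewrite pnatE // inE p_prime /= -polyC_natr pF0.
Qed.

Definition root_quot (a : F) : {poly F} := all_roots %/ ('X + a%:P).

Lemma root_quotE a : root_quot a * ('X + a%:P) = all_roots.
Proof.
apply: divpK; rewrite -[a]opprK polyCN dvdp_XsubCl /root /all_roots.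
by rewrite !hornerE fermat subrr.
Qed.

Lemma root_quot_shift (a c : F) :
  root_quot a \Po ('X + c%:P) = root_quot (a + c).
Proof.
have X0 : 'X + (a + c)%:P != 0 by rewrite -size_poly_eq0 size_XaddC.
apply: (mulIf X0); rewrite root_quotE -(all_roots_shift c) -(root_quotE a).
by rewrite comp_polyM comp_polyD comp_polyX comp_polyC polyCD; ring.
Qed.

(** Here L^2 = X^(2p) - 2X^(p+1) + X^2, and p + 1 exceeds 5. *)
Lemma coef_sqr_all_roots i : (i < 5)%N -> (all_roots ^+ 2)`_i = (i == 2)%:R.
Proof.
move=> i5; have -> : all_roots ^+ 2 = 'X^(p * 2) - 'X^(p.+1) *+ 2 + 'X^2.
  by rewrite /all_roots exprM (exprS 'X p); ring.
rewrite !coefE (_ : (i == p * 2)%N = false); last lia.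
by rewrite (_ : (i == p.+1)%N = false) ?mul0rn ?subr0 ?add0r; last lia.
Qed.

(** For nonzero a the product is L^2/(X+a), which begins X^2/a - X^3/a^2, and a^(-2) = a^(p-3) by
    Fermat. For a = 0 both sides vanish. *)
Lemma coef3_root_quot a : (all_roots * root_quot a)`_3 = - a ^+ (p - 3).
Proof.
set q := all_roots * _.
have qE : q * 'X + a *: q = all_roots ^+ 2.
  by rewrite -mul_polyC expr2 -[X in _ = _ * X](root_quotE a) /q; ring.
have c i : (i < 5)%N -> (q * 'X)`_i + a * q`_i = (i == 2)%:R.
  by move=> i5; rewrite -coef_sqr_all_roots // -qE coefD coefZ.
have := c 0 isT; have := c 1 isT; have := c 2 isT; have := c 3 isT.
have := c 4 isT; rewrite !coefMX /= ?mulr0n ?mulr1n.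
have [->|a0] := eqVneq a 0.
  rewrite !mul0r !addr0 => -> _ _ _ _.
  by rewrite expr0n subn_eq0 leqNgt (ltn_trans _ p_gt4) // oppr0.
move=> _ c3 c2 c1 c0.
have q0 : q`_0 = 0.
  by move: c0; rewrite add0r => /eqP; rewrite mulf_eq0 (negPf a0) => /eqP.
have q1 : q`_1 = 0.
  by move: c1; rewrite q0 add0r => /eqP; rewrite mulf_eq0 (negPf a0) => /eqP.
have q2 : q`_2 = a^-1.
  by apply: (mulfI a0); rewrite mulfV //; move: c2; rewrite q1 add0r.
have a1 : a ^+ p.-1 = 1.
  by apply: (mulfI a0); rewrite mulr1 -exprS prednK ?prime_gt0.
have e : a ^+ (p - 3) = a^-1 * a^-1.
  have : a ^+ (p - 3) * a ^+ 2 = 1 by rewrite -exprD -[RHS]a1; congr (_ ^+ _); lia.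
  by move/(canRL (mulfK (expf_neq0 2 a0))) => ->; field.
apply: (mulfI a0); rewrite e; move/eqP: c3; rewrite q2 addrC addr_eq0 => /eqP ->.
by field.
Qed.

(** Iterating v(X+c) = g - v returns to v after p shifts, as pc = 0; p being odd, the two copies of
    v add up. *)
Lemma alternating_shift (c : F) (v g : {poly F}) :
  v \Po ('X + c%:P) + v = g ->
  2 * v = \sum_(j < p) (-1) ^+ j * (g \Po ('X + (c * j%:R)%:P)).
Proof.
move=> vg; have partial m : \sum_(j < m) (-1) ^+ j * (g \Po ('X + (c * j%:R)%:P)) =
    v - (-1) ^+ m * (v \Po ('X + (c * m%:R)%:P)).
  elim: m => [|m IHm]; first by rewrite big_ord0 mulr0 addr0 comp_polyXr; ring.
  have -> : v \Po ('X + (c * m.+1%:R)%:P) =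
      (v \Po ('X + c%:P)) \Po ('X + (c * m%:R)%:P).
    rewrite -comp_polyA comp_polyD comp_polyX comp_polyC -natr1 mulrDr mulr1.
    by rewrite polyCD addrA.
  by rewrite big_ord_recr /= IHm -vg comp_polyD exprS; ring.
by rewrite partial -signr_odd p_odd pF0 mulr0 addr0 comp_polyXr; ring.
Qed.

Lemma coef2_shift_solution (w : {poly F}) :
  (w \Po ('X + 4%:P)) * ('X + 4%:P) + w * 'X = all_roots * (root_quot 1 + root_quot 3) ->
  w`_2 = - \sum_(j < p) (-1) ^+ j * (1 + 4 * j%:R) ^+ (p - 3).
Proof.
move=> e; apply: (mulfI two0).
have {}e : (w * 'X) \Po ('X + 4%:P) + w * 'X = all_roots * (root_quot 1 + root_quot 3).
  by rewrite comp_polyM comp_polyX.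
have := congr1 (fun q : {poly F} => q`_3) (alternating_shift _ _ _ e).
rewrite -[2 in X in X -> _]polyC_natr coefCM coefMX /= => ->.
rewrite coef_sum mulrN mulr_sumr -sumrN.
(* The reflection of j to p-1-j sends 3+4j to -(1+4j) and preserves signs, p-1 and p-3 being even.
   The two root quotients thus contribute equally, which cancels the factor 2. *)
have refl : \sum_(j < p) (-1) ^+ j * (3 + 4 * j%:R) ^+ (p - 3) =
    \sum_(j < p) (-1) ^+ j * (1 + 4 * j%:R) ^+ (p - 3) :> F.
  rewrite (reindex_inj rev_ord_inj) /=; apply: eq_bigr => j _.
  have -> : (p - j.+1)%:R = - (j%:R + 1) :> F.
    by rewrite natrB ?ltn_ord // pF0 -natr1; ring.
  have -> : 3 + 4 * - (j%:R + 1) = - (1 + 4 * j%:R) :> F by ring.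
  rewrite [X in _ * X]exprNn -[X in X * (_ * _)]signr_odd -[X in _ * (X * _)]signr_odd.
  rewrite !oddB ?ltn_ord ?(ltnW (ltnW p_gt4)) // p_odd /= negbK signr_odd.
  by rewrite mul1r.
have -> : \sum_(i < p) - (2 * ((-1) ^+ i * (1 + 4 * i%:R) ^+ (p - 3))) =
   - \sum_(j < p) (-1) ^+ j * (1 + 4 * j%:R) ^+ (p - 3)
   - \sum_(j < p) (-1) ^+ j * (3 + 4 * j%:R) ^+ (p - 3) :> F.
  by rewrite refl -!sumrN -big_split /=; apply: eq_bigr => i _; ring.
rewrite -!sumrN -big_split /=; apply: eq_bigr => j _.
rewrite -polyC1 -polyCN -polyC_exp coefCM comp_polyM all_roots_shift comp_polyD.
rewrite !root_quot_shift mulrDr coefD !coef3_root_quot; ring.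
Qed.

Lemma den_factors_Fp : den_factors {poly F} p 'X * 'X^2 = all_roots ^+ 2.
Proof.
have fourN0 : (-4 : F) != 0 by rewrite oppr_eq0.
(* Both 4i and -4i run through the whole field; the factor i = 0 supplies the X^2 of the
   statement. *)
have -> : all_roots ^+ 2 = - \prod_(i < p) (16 * i%:R ^+ 2 - 'X ^+ 2).
  rewrite expr2 -{1}(prod_affine _ 0 four0) -(prod_affine _ 0 fourN0) -big_split.
  have -> : - \prod_(i < p) (16 * i%:R ^+ 2 - 'X ^+ 2) =
      \prod_(i < p) - (16 * i%:R ^+ 2 - 'X ^+ 2) :> {poly F}.
    by rewrite prodrN card_ord -signr_odd p_odd; ring.
  apply: eq_bigr => i _; rewrite !addr0 mulNr polyCN polyCM !polyC_natr /=.
  ring.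
rewrite -(big_mkord xpredT (fun i => 16 * i%:R ^+ 2 - 'X ^+ 2)) big_ltn ?prime_gt0 //.
by rewrite /den_factors; ring.
Qed.

Lemma den_factors_Fp_coef :
  (den_factors {poly F} p 'X)`_0 = 1 /\ (den_factors {poly F} p 'X)`_2 = 0.
Proof.
have e i : (i < 3)%N -> (den_factors {poly F} p 'X)`_i = (i == 0)%:R.
  move=> i3; have := coef_sqr_all_roots i.+2.
  by rewrite -den_factors_Fp coefMXn /= subn2 /= => ->.
by rewrite !e.
Qed.

(** Extending the product to all i < p adds i = k and i = k+1, that is -2 and -1 modulo p, whose
    factors multiply to (X+1)^2 (X+3)^2. Each linear family then runs over the whole field. *)
Lemma cert_factors_Fp k : p = k.+2 ->
  cert_factors {poly F} k 'X * (('X + 1) * ('X + 3)) ^+ 2 = - all_roots ^+ 2.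
Proof.
move=> pk.
have twoN0 : (-2 : F) != 0 by rewrite oppr_eq0.
have -> : - all_roots ^+ 2 =
    \prod_(i < p) (((2 * i + 1)%:R - 'X) * ((2 * i + 5)%:R + 'X)).
  rewrite expr2 -{1}(prod_affine _ (-1) twoN0) -(prod_affine _ 5 two0).
  rewrite -mulNr -[X in X * _](_ : \prod_(i < p) - ('X + (-2 * i%:R + -1)%:P) = _).
    rewrite -big_split; apply: eq_bigr => i _.
    by rewrite /= !(polyCD, polyCM, polyCN, polyC_natr); ring.
  by rewrite prodrN card_ord -signr_odd p_odd; ring.
set f := fun i : nat => ((2 * i + 1)%:R - 'X) * ((2 * i + 5)%:R + 'X) : {poly F}.
have -> : \prod_(i < p) f i = \prod_(i < k.+2) f i.
  by rewrite -!(big_mkord xpredT f); congr (\big[_/_]_(i <- index_iota 0 _) _).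
rewrite !big_ord_recr /= -/(cert_factors _ k _) /f.
have e : k%:R = -2 :> {poly F}.
  have : (k + 2)%:R = 0 :> {poly F} by rewrite addn2 -pk -polyC_natr pF0.
  by rewrite natrD => /eqP; rewrite addr_eq0 => /eqP.
have c m n : (2 * m + n)%:R = 2 * m%:R + n%:R :> {poly F} by rewrite natrD natrM.
have kS : k.+1%:R = -1 :> {poly F} by rewrite -natr1 e; ring.
by rewrite !c kS e; ring.
Qed.

(** In Vandermonde's sum p divides every term but the first and the last. *)
Lemma central_bin_Fp : 'C(2 * p, p)%:R = 2 :> F.
Proof.
rewrite mul2n -addnn -binomial.Vandermonde big_ord_recr natrD natr_sum /=.
rewrite (bigD1 (Ordinal (prime_gt0 p_prime))) //= big1 => [|i i0].
  by rewrite !subn0 subnn !bin0 binn; ring.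
have ip : (0 < i < p)%N by rewrite ltn_ord lt0n andbT -val_eqE in i0 *.
rewrite natrM; have /eqP -> : 'C(p, i)%:R == 0 :> F.
  by rewrite -(dvdn_pcharf p_char) prime_dvd_bin.
by rewrite mul0r.
Qed.

End FpPoly.

(** * Exact values at odd arguments *)

Section SpecialValues.
Implicit Types (n k m i : nat).

Lemma odd_factors_eq0 n m : (m < n)%N -> odd_factors int n (2 * m + 1)%:R = 0.
Proof.
by move=> mn; rewrite /odd_factors (bigD1 (Ordinal mn)) //= subrr mul0r.
Qed.

(** That is, S(2m+1) = (-1)^(m/2) (2m+1), with m/2 rounded down. The step w to w+4 raises m by 2,
    and the right side of [num_sum_shift] vanishes there because [cert_factors] contains 2m+1-w. *)
Lemma num_sum_odd n m : (m < n)%N ->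
  num_sum int n (2 * m + 1)%:R =
    8 ^+ n.-1 * den_factors int n (2 * m + 1)%:R * (-1) ^+ m./2 * (2 * m + 1)%:R.
Proof.
(* The terms of index above l vanish, so a longer sum only gains denominator factors. *)
have step j l : (l < j)%N ->
    num_sum int j (2 * l + 1)%:R =
      8 ^+ j.-1 * den_factors int j (2 * l + 1)%:R * (-1) ^+ l./2 * (2 * l + 1)%:R ->
    num_sum int j.+1 (2 * l + 1)%:R =
      8 ^+ j * den_factors int j.+1 (2 * l + 1)%:R * (-1) ^+ l./2 * (2 * l + 1)%:R.
  case: j => // j lj e; rewrite num_sumS odd_factors_eq0 // e (den_factorsS _ j.+1) //.
  by rewrite [j.+1.-1]/= [in RHS]exprS; ring.
elim/ltn_ind: m n => -[|[|m]] IHm n mn.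
- elim: n mn => // -[|n] IHn _; last by apply: step; rewrite ?IHn.
  by rewrite /= /odd_factors /den_factors big_geq // big_ord0.
- elim: n mn => // -[|[|n]] IHn // _; last by apply: step; rewrite ?IHn.
  by rewrite /= /odd_factors /den_factors big_nat1 !big_ord_recr !big_ord0.
case: n mn => [|[|k]] // mk; set w : int := (2 * m + 1)%:R.
have -> : (2 * m.+2 + 1)%:R = w + 4 by rewrite /w; ring.
have c0 : cert_factors int k w = 0.
  have mk' : (m < k)%N by lia.
  by rewrite /cert_factors (bigD1 (Ordinal mk')) //= subrr !mul0r.
have d0 : (4 * k + 4)%:R - w != 0 by rewrite /w; lia.
apply: (mulfI d0).
have := num_sum_shift _ k w; rewrite c0 mulr0 => /subr0_eq ->.
rewrite {1}/w IHm //; last lia.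
have := den_factors_shift _ k.+1 w; rewrite (_ : (4 * k.+1)%N = (4 * k + 4)%N); last lia.
rewrite [k.+2.-1]/= [m.+2./2]/= (exprS (-1)) -/w => e.
transitivity (- 8 ^+ k.+1 * (-1) ^+ m./2 *
  (den_factors int k.+2 (w + 4) * (((4 * k + 4)%:R - w) * (w + 4)))); last by ring.
by rewrite e; ring.
Qed.

Lemma fact_even_odd m :
  (m`! = \prod_(i < m./2) (2 * i.+1) * \prod_(i < uphalf m) (2 * i + 1))%N.
Proof.
elim: m => [|m IHm]; first by rewrite !big_ord0.
rewrite factS IHm /=; have := odd_double_half m; rewrite uphalf_half.
case: (odd m) => /= e; last by rewrite !add0n big_ord_recr /=; lia.
by rewrite !add1n [in RHS]big_ord_recr /= ; lia.
Qed.

Lemma prod_nat_rev_tail (R : comNzRingType) (g : nat -> R) m a : (a <= m)%N ->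
  \prod_(m - a <= i < m) g i = \prod_(j < a) g (m - j.+1)%N.
Proof.
elim: a => [|a IHa] am; first by rewrite subn0 big_geq // big_ord0.
rewrite big_ltn; last lia.
by rewrite big_ord_recr /= mulrC -IHa ?(ltnW am) // -subSn // subSS.
Qed.

(** * The quadratic character of -2 *)

Section Legendre.
Variable p : nat.
Hypothesis p_prime : prime p.
Hypothesis p_gt2 : (2 < p)%N.
Local Notation F := 'F_p.
Let m := p./2.

Let p_odd : p = (2 * m + 1)%N.
Proof.
have odd_p : odd p by case: (even_prime p_prime) p_gt2 => // ->.
by rewrite /m; have := odd_double_half p; rewrite odd_p; lia.
Qed.

Let natF_eq0 i : ((i%:R : F) == 0) = (p %| i)%N.
Proof. by rewrite -(dvdn_pcharf (pchar_Fp p_prime)). Qed.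

(* Gauss: modulo p = 2m + 1 the numbers -2i, 1 <= i <= m, are minus the even
   numbers up to m and the odd numbers up to m. *)
Lemma expr_m2_half : (-2 : F) ^+ m = (-1) ^+ m./2.
Proof.
have fact0 k : (k < p)%N -> (k`!%:R : F) != 0.
  elim: k => [|k IHk] kp; first by rewrite oner_eq0.
  by rewrite factS natrM mulf_neq0 ?IHk ?natF_eq0 ?gtnNdvd // ltnW.
have mp : (m < p)%N by lia.
apply: (mulIf (fact0 m mp)).
pose g i : F := -2 * i.+1%:R.
have factE : m`!%:R = \prod_(i < m) i.+1%:R :> F.
  by rewrite fact_prod natr_prod big_add1 big_mkord.
have <- : \prod_(i < m) g i = (-2) ^+ m * m`!%:R.
  by rewrite factE /g big_split /= prodr_const card_ord.
(* The lower part gives the negated even numbers; in the upper part, -2(m-j) = 2j+1 modulo p. *)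
rewrite -(big_mkord xpredT g) (big_cat_nat _ (n := m./2)) //=; last lia.
rewrite {2}(_ : m./2 = m - uphalf m)%N; last by rewrite uphalf_half; lia.
rewrite prod_nat_rev_tail; last by rewrite uphalf_half; lia.
rewrite fact_even_odd natrM !natr_prod mulrA big_mkord; congr (_ * _).
  have -> : (-1) ^+ m./2 = \prod_(i < m./2) (-1) :> F by rewrite prodr_const card_ord.
  by rewrite -big_split; apply: eq_bigr => i _; rewrite /g natrM /=; ring.
apply: eq_bigr => i _; rewrite /g.
have im : (i < m)%N by apply: leq_trans (ltn_ord i) _; rewrite uphalf_half; lia.
have /eqP : (2 * (m - i.+1).+1 + (2 * i + 1))%:R == 0 :> F.
  by rewrite natF_eq0 (_ : (_ + _)%N = p) //; lia.
by rewrite natrD natrM => /eqP; rewrite addrC addr_eq0 => /eqP ->; ring.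
Qed.

Lemma euler_criterion (a : F) : a != 0 ->
  [exists x : F, x ^+ 2 == a] = (a ^+ m == 1).
Proof.
move=> a0; have fermat (x : F) : x != 0 -> x ^+ (2 * m) = 1.
  move=> x0; apply: (mulfI x0); rewrite -exprS -addn1 -p_odd mulr1.
  by have := expf_card x; rewrite card_Fp.
apply/existsP/eqP => [[x /eqP xa]|am1].
  by rewrite -xa -exprM fermat //; apply: contra_neq a0 => x0; rewrite -xa x0 expr0n.
apply/existsP; apply: contraT; rewrite negb_exists => /forallP nsq.
have m_gt0 : (0 < m)%N by lia.
(* If a were not a square, a and the m distinct squares of 1, ..., m would be m+1 roots of X^m -
   1. *)
pose rs := a :: [seq (i%:R : F) ^+ 2 | i <- iota 1 m].
have rs_uniq : uniq rs.
  rewrite /= map_inj_in_uniq ?iota_uniq ?andbT.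
    by apply/mapP => -[i _ ai]; have := nsq i%:R; rewrite ai eqxx.
  move=> i j; rewrite !mem_iota => ib jb /eqP; rewrite eqf_sqr => /orP[]/eqP e.
    wlog ij : i j ib jb e / (j <= i)%N.
      by move=> W; case: (leqP j i) => [/W->//|/ltnW/W->].
    apply/eqP; rewrite eqn_leq ij andbT -subn_eq0; apply/eqP.
    have : (p %| i - j)%N by rewrite -natF_eq0 natrB // e subrr.
    by case: (i - j)%N (leq_subr j i) => // d dl /dvdn_leq; lia.
  have : (p %| i + j)%N by rewrite -natF_eq0 natrD e addNr.
  by move/dvdn_leq; lia.
have rs_root : all (root ('X^m - 1)) rs.
  apply/allP => x; rewrite inE => /orP[/eqP->|/mapP[i]].
    by rewrite rootE !hornerE am1 subrr.
  rewrite mem_iota => ib ->; rewrite rootE !hornerE -exprM fermat ?subrr //.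
  by rewrite natF_eq0; apply/negP => /dvdn_leq; lia.
have X0 : 'X^m - 1 != 0 :> {poly F} by rewrite -size_poly_eq0 size_XnsubC.
have := max_poly_roots X0 rs_root rs_uniq.
by rewrite size_XnsubC // /= size_map size_iota ltnn.
Qed.

Lemma legendre_m2 : legendre (-2) p = (-1) ^+ m./2.
Proof.
have e : (-2)%:~R = -2 :> F by rewrite rmorphN.
have two0 : (-2 : F) != 0.
  by rewrite oppr_eq0 (natF_eq0 2); apply/negP => /dvdn_leq; lia.
rewrite /legendre e (negPf two0) euler_criterion // expr_m2_half.
rewrite -!(signr_odd _ m./2); case: (odd _); rewrite ?eqxx //=.
rewrite expr1 eq_sym -subr_eq0 opprK; have -> : 1 + 1 = -(-2) :> F by ring.
by rewrite oppr_eq0 (negPf two0).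
Qed.

End Legendre.
End SpecialValues.

(** * Compatibility with ring morphisms, and the value at 0 *)

Section Functoriality.
Variables (R S : comNzRingType) (f : {rmorphism R -> S}).

Lemma rmorph_odd_factors n w : f (odd_factors R n w) = odd_factors S n (f w).
Proof.
rewrite /odd_factors rmorph_prod; apply: eq_bigr => i _.
by rewrite rmorphB !rmorphXn rmorph_nat.
Qed.

Lemma rmorph_num_sum n w : f (num_sum R n w) = num_sum S n (f w).
Proof.
elim: n => [|n IHn]; first by rewrite rmorph0.
rewrite !num_sumS rmorphD !rmorphM rmorphB rmorphM !rmorphXn !rmorph_nat rmorphN1.
by rewrite IHn rmorph_odd_factors.
Qed.

Lemma rmorph_den_factors n w : f (den_factors R n w) = den_factors S n (f w).
Proof.
rewrite /den_factors rmorph_prod; apply: eq_bigr => i _.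
by rewrite rmorphB rmorphM !rmorphXn !rmorph_nat.
Qed.

Lemma rmorph_cert_factors k w : f (cert_factors R k w) = cert_factors S k (f w).
Proof.
rewrite /cert_factors rmorph_prod; apply: eq_bigr => i _.
by rewrite rmorphM rmorphB rmorphD !rmorph_nat.
Qed.

End Functoriality.

Lemma num_sum0 (R : numFieldType) n : (0 < n)%N ->
  num_sum R n 0 = 8 ^+ n.-1 * den_factors R n 0 *
    \sum_(0 <= k < n) (6 * k + 1)%N%:R / (-512) ^+ k * 'C(2 * k, k)%:R ^+ 3.
Proof.
(* At w = 0 the quotient of the two products is C(2k,k)^2 / 64^k; with (-1/8)^k this produces the
   cube and (-512)^k. *)
have odd0 k : odd_factors R k 0 * 64 ^+ k = den_factors R k.+1 0 * 'C(2 * k, k)%:R ^+ 2.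
  elim: k => [|k IHk].
    by rewrite /odd_factors /den_factors big_geq // big_ord0 muln0 bin0 expr1n; ring.
  rewrite den_factorsS // /odd_factors big_ord_recr -/(odd_factors _ k 0) (exprS 64) /=.
  have cS : k.+1%:R * 'C(2 * k.+1, k.+1)%:R = 2 * (2 * k + 1)%:R * 'C(2 * k, k)%:R :> R.
    by rewrite -!natrM mul_central_bin.
  transitivity (odd_factors R k 0 * 64 ^+ k * (64 * (2 * k + 1)%:R ^+ 2)); first by ring.
  rewrite IHk.
  transitivity (den_factors R k.+1 0 * 16
    * (k.+1%:R * 'C(2 * k.+1, k.+1)%:R) ^+ 2); last by ring.
  by rewrite cS; ring.
elim: n => // -[|n] IHn _.
  rewrite big_nat1 /= /odd_factors /den_factors big_geq // big_ord0 !muln0 bin0.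
  by rewrite !expr0; field.
rewrite num_sumS IHn // [in RHS]big_nat_recr //= (den_factorsS _ n.+1) //.
have o : odd_factors R n.+1 0 =
    den_factors R n.+1 0 * (16 * n.+1%:R ^+ 2) * 'C(2 * n.+1, n.+1)%:R ^+ 2 / 64 ^+ n.+1.
  apply: (canRL (mulfK _)); first by rewrite expf_neq0 // pnatr_eq0.
  by rewrite odd0 den_factorsS //; ring.
have e512 : (8 : R) ^+ n.+1 / (-512) ^+ n.+1 = (-1) ^+ n.+1 / 64 ^+ n.+1.
  have h : 8 / -512 = -1 / 64 :> R by field.
  by rewrite -!expr_div_n h.
rewrite [in RHS]mulrDr; congr (_ + _).
  by rewrite [LHS]mulrA; congr (_ * _); rewrite (exprS 8 n); ring.
transitivity ((6 * n.+1 + 1)%:R * den_factors R n.+1 0 * (16 * n.+1%:R ^+ 2)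
    * 'C(2 * n.+1, n.+1)%:R ^+ 3 * ((-1) ^+ n.+1 / 64 ^+ n.+1)).
  by rewrite o; ring.
by rewrite -e512; ring.
Qed.

(** * Dividing by p and reading off coefficients *)

Section Assembly.
Variable p : nat.
Hypothesis p_prime : prime p.
Hypothesis p_gt4 : (4 < p)%N.
Local Notation F := 'F_p.
Local Notation red := (map_poly (intr : int -> F)).

Let p_odd : odd p.
Proof. by case: (even_prime p_prime) p_gt4 => // ->. Qed.

Let pF0 : p%:R = 0 :> F. Proof. exact: pcharf0 (pchar_Fp p_prime). Qed.

Let two0 : (2 : F) != 0.
Proof.
by rewrite -(dvdn_pcharf (pchar_Fp p_prime)); apply/negP => /dvdn_leq; lia.
Qed.

Lemma num_sum_comp (R : comNzRingType) n (c : R) :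
  num_sum {poly R} n 'X \Po ('X + c%:P) = num_sum {poly R} n ('X + c%:P).
Proof.
by have := rmorph_num_sum _ _ (comp_poly ('X + c%:P)) n 'X; rewrite /= comp_polyX.
Qed.

(** For p = k+2 the recurrence modulo p reads v(X+4) + v(X) = 0 with v = X N, so [alternating_shift]
    with g = 0 gives 2v = 0. *)
Lemma num_sum_Fp : num_sum {poly F} p 'X = 0.
Proof.
have [k pk] : exists k, p = k.+2 by exists (p - 2)%N; lia.
have := num_sum_shift {poly F} k 'X; rewrite -pk.
have pP0 : p%:R = 0 :> {poly F} by rewrite -polyC_natr pF0.
have -> : (4 * k + 8)%:R = 0 :> {poly F}.
  by rewrite (_ : (_ + _)%N = 4 * p)%N ?natrM ?pP0 ?mulr0 //; lia.
have -> : (4 * k + 4)%:R = -4 :> {poly F}.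
  apply/eqP; rewrite -addr_eq0 -natrD (_ : (_ + _)%N = 4 * p)%N ?natrM ?pP0 ?mulr0 //.
  lia.
rewrite natrM pP0 mul0r mulr0 !mul0r add0r.
rewrite -[4]polyC_natr -num_sum_comp => e.
have {}e : (num_sum {poly F} p 'X * 'X) \Po ('X + 4%:P) + num_sum {poly F} p 'X * 'X = 0.
  rewrite comp_polyM comp_polyX -oppr0 -e; ring.
have := alternating_shift p p_prime p_gt4 _ _ _ e.
rewrite big1 => [|j _]; last by rewrite comp_poly0 mulr0.
move/eqP; rewrite !mulf_eq0 polyX_eq0 orbF -polyC_natr polyC_eq0 (negPf two0).
by move/eqP.
Qed.

(** In the recurrence for p = k+2 the left side is divisible by p through N = p W, the right side
    through the factor k+2. The quotient by p, reduced modulo p, is the equation of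
    [coef2_shift_solution]. *)
Lemma num_sum_quot :
  exists2 W : {poly int}, num_sum {poly int} p 'X = p%:R * W &
    (red W)`_2 = - \sum_(j < p) (-1) ^+ j * (1 + 4 * j%:R) ^+ (p - 3).
Proof.
set N := num_sum {poly int} p 'X.
have redX : red 'X = 'X by rewrite map_polyX.
have redN : red N = 0.
  have := rmorph_num_sum _ _ (red : {rmorphism {poly int} -> {poly F}}) p 'X.
  rewrite [RHS]/= redX num_sum_Fp; apply.
pose W := \poly_(i < size N) (N`_i %/ p)%Z.
have NW : N = p%:R * W.
  apply/polyP => i; rewrite -polyC_natr coefCM coef_poly.
  case: ltnP => [_|/(nth_default 0) ->]; last by rewrite mulr0.
  have : (p %| N`_i)%Z by rewrite -intr_Fp_eq0 // -coef_map redN coef0.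
  by move/divzK => {1}<-; rewrite mulrC natz.
exists W => //; apply: coef2_shift_solution => //.
have [k pk] : exists k, p = k.+2 by exists (p - 2)%N; lia.
have := num_sum_shift {poly int} k 'X; rewrite -pk.
have -> : ('X + 4 : {poly int}) = 'X + 4%:P by rewrite polyC_natr.
rewrite -num_sum_comp -/N NW comp_polyM -[p%:R]polyC_natr comp_polyC polyC_natr natrM.
set Wc := W \Po _; set c := 'C(_, _)%:R; set f := cert_factors _ _ _ => e.
have {}e : ((4 * k + 4)%:R - 'X) * Wc - ((4 * k + 8)%:R + 'X) * W =
    c * (('X + 1) * ('X + 2) * ('X + 3)) * f.
  have p0 : p%:R != 0 :> {poly int} by rewrite -polyC_natr polyC_eq0 pnatr_eq0; lia.
  apply: (mulfI p0).
  transitivity (((4 * k + 4)%:R - 'X) * (p%:R * Wc) - ((4 * k + 8)%:R + 'X) * (p%:R * W)).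
    by ring.
  have k_odd : odd k.+1 = false by move: p_odd; rewrite pk /= negbK => ->.
  by rewrite e -signr_odd k_odd expr0; ring.
have redf : red f = cert_factors {poly F} k 'X.
  have := rmorph_cert_factors _ _ (red : {rmorphism {poly int} -> {poly F}}) k 'X.
  by rewrite /= map_polyX; apply.
have -> : red W \Po ('X + 4%:P) = red Wc.
  rewrite /Wc map_comp_poly; congr (_ \Po _).
  by rewrite [RHS]rmorphD /= map_polyX map_polyC.
have binE : 'C(2 * p, p)%:R = 2 :> {poly F}.
  by rewrite -polyC_natr central_bin_Fp // polyC_natr.
have kE : k%:R = -2 :> {poly F}.
  have : (k + 2)%:R = 0 :> {poly F} by rewrite addn2 -pk -polyC_natr pF0.
  by rewrite natrD => /eqP; rewrite addr_eq0 => /eqP.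
have {}e := congr1 (red : {poly int} -> {poly F}) e.
rewrite /= !(rmorphB, rmorphM, rmorphD, rmorph_nat, rmorph1) /= redX redf binE !kE in e.
move: (red Wc) (red W) e => Y w e.
have cf := cert_factors_Fp p p_prime p_gt4 k pk.
have q1 := root_quotE p p_prime 1; have q3 := root_quotE p p_prime 3.
rewrite polyC1 in q1; rewrite polyC_natr in q3; rewrite polyC_natr.
have X13 : ('X + 1) * ('X + 3) != 0 :> {poly F}.
  by rewrite mulf_neq0 // -?polyC1 -?polyC_natr -size_poly_eq0 size_XaddC.
(* This factor completes [cert_factors] to -L^2 on one side and clears both root quotients on the
   other. *)
apply: (mulIf X13).
transitivity (- (2 * (('X + 1) * ('X + 2) * ('X + 3)) * cert_factors {poly F} k 'X)
  * (('X + 1) * ('X + 3))).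
  congr (_ * _); apply/eqP; rewrite -addr_eq0; apply/eqP.
  by rewrite -[2 * _ * _]e; ring.
transitivity (- (2 * ('X + 2)) * (cert_factors {poly F} k 'X * (('X + 1) * ('X + 3)) ^+ 2)).
  by ring.
rewrite cf.
transitivity (all_roots p * ((root_quot p 1 * ('X + 1)) * ('X + 3)
  + (root_quot p 3 * ('X + 3)) * ('X + 1))).
  by rewrite q1 q3; ring.
by ring.
Qed.

Lemma num_sum_at0 : exists x : int,
  num_sum int p 0 =
    p%:Z * legendre (-2) p * (8 ^+ p.-1 * den_factors int p 0)
      + p%:Z ^+ 3 * \sum_(j < p) (-1) ^+ j * (1 + 4 * j%:Z) ^+ (p - 3)
      + p%:Z ^+ 4 * x.
Proof.
have [W NW W2] := num_sum_quot.
set eps := legendre (-2) p; set T := \sum_(j < p) _.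
pose D := den_factors {poly int} p 'X.
(* V is even and vanishes at p, so its constant term is -p^2 times its X^2 coefficient modulo p^3.
   That coefficient agrees with the one of W modulo p, as D has none there. *)
pose V := W - (8 ^+ p.-1 * eps)%:P * D.
have evalN x : p%:Z * W.[x] = num_sum int p x.
  have := rmorph_num_sum _ _ (horner_eval x) p ('X : {poly int}).
  by rewrite /= /horner_eval hornerX NW -polyC_natr hornerCM natz.
have evalD x : D.[x] = den_factors int p x.
  have := rmorph_den_factors _ _ (horner_eval x) p ('X : {poly int}).
  by rewrite /= /horner_eval hornerX.
have p0 : p%:Z != 0 by lia.
have Vp : V.[p%:Z] = 0.
  rewrite /V hornerD hornerN hornerCM evalD.
  apply: (mulfI p0); rewrite mulrBr evalN mulr0.
  have mp : (p./2 < p)%N by lia.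
  have := num_sum_odd p p./2 mp.
  have -> : (2 * p./2 + 1)%:R = p%:Z by rewrite natz; lia.
  by move=> ->; rewrite /eps legendre_m2 //; [ring | lia].
have V1 : V`_1 = 0.
  have Veven : V \Po (- 'X) = V.
    have pP0 : (p%:R : {poly int}) != 0 by rewrite -polyC_natr polyC_eq0 pnatr_eq0; lia.
    have DE : D \Po (- 'X) = D.
      have := rmorph_den_factors _ _ (comp_poly (- 'X : {poly int})) p 'X.
      by rewrite /= comp_polyX den_factorsN.
    have WE : W \Po (- 'X) = W.
      apply: (mulfI pP0); rewrite -NW.
      have := rmorph_num_sum _ _ (comp_poly (- 'X : {poly int})) p 'X.
      by rewrite /= comp_polyX num_sumN NW comp_polyM -polyC_natr comp_polyC.
    by rewrite /V comp_polyB comp_polyM comp_polyC WE DE.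
  (* Differentiating V(-X) = V(X) at 0 shows that the linear coefficient equals its negative. *)
  have := congr1 (fun q => q^`().[0]) Veven; rewrite deriv_comp derivN derivX.
  rewrite hornerM horner_comp !hornerN hornerX hornerC oppr0 horner_coef0 coef_deriv.
  by rewrite mulr1n mulrN1 => /eqP; rewrite eqNr => /eqP.
have [t Vt] : exists t, V`_2 = - T + p%:Z * t.
  apply: (intr_Fp_eq p p_prime).
  have [_ D2] := den_factors_Fp_coef p p_prime p_gt4.
  rewrite /V coefB coefCM rmorphB rmorphM /= -(coef_map intr W) W2.
  have -> : (D`_2)%:~R = 0 :> F.
    rewrite -D2 -(coef_map intr D).
    have := rmorph_den_factors _ _ (red : {rmorphism {poly int} -> {poly F}}) p 'X.
    by rewrite /= map_polyX => ->.
  rewrite mulr0 subr0 rmorphN rmorph_sum /=; congr (- _); apply: eq_bigr => j _.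
  by rewrite rmorphM !rmorphXn rmorphN1 rmorphD rmorphM rmorph1.
pose U := drop_poly 3 V.
have V0 : V`_0 = - (p%:Z ^+ 2 * V`_2 + p%:Z ^+ 3 * U.[p%:Z]).
  have := Vp; rewrite -{1}[V](poly_take_drop 3) hornerD hornerM hornerXn.
  rewrite /take_poly horner_poly !big_ord_recl big_ord0 /= /bump /= V1 -/U => e.
  by apply/eqP; rewrite -addr_eq0 -[X in _ == X]e; apply/eqP; ring.
have -> : num_sum int p 0 = p%:Z * (V`_0 + 8 ^+ p.-1 * eps * den_factors int p 0).
  by rewrite -evalN -evalD !horner_coef0 /V coefB coefCM; ring.
by exists (- (t + U.[p%:Z])); rewrite V0 Vt; ring.
Qed.

End Assembly.

(** * The congruence modulo p^4 *)

Theorem theorem1p3 (p : nat) (p_prime : prime p) (p_gt3 : (3 < p)%N) :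
  eqmod_plocal p (p%:R ^+ 4)
    (\sum_(0 <= n < p) (6 * n + 1)%N%:R / (-512) ^+ n * 'C(2 * n, n)%:R ^+ 3)
    (p%:R * (legendre (-2) p)%:~R
       + p%:R ^+ 3 / 16 * (euler_poly (p - 3)).[1 / 4]).
Proof.
have p_neq4 : p != 4 by apply: contraTneq p_prime => ->.
have p_gt4 : (4 < p)%N by lia.
have p_gt2 : (2 < p)%N by lia.
set A : int := 8 ^+ p.-1 * den_factors int p 0.
set S := \sum_(0 <= n < p) _; set E := (euler_poly _).[_].
have [x N0] := num_sum_at0 p p_prime p_gt4.
have [c pc Tc] := alternating_sum_quarter p p_prime p_gt2 (p - 3).
rewrite -/A in N0; rewrite /euler_val -/E in Tc.
set T := \sum_(j < p) _ in N0 Tc.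
have fermat (y : int) : (y%:~R : 'F_p) != 0 -> ((y ^+ p.-1)%:~R : 'F_p) = 1.
  move=> y0; apply: (mulfI y0).
  rewrite rmorphXn /= -exprS prednK ?prime_gt0 // mulr1.
  by have := expf_card (y%:~R : 'F_p); rewrite card_Fp.
have pow2_neq0 k : (((2 ^+ k : int))%:~R : 'F_p) != 0.
  rewrite intr_Fp_eq0 //; apply/negP => d.
  have := coprimez_pow2 p p_prime p_gt2 k.
  rewrite coprimezE prime_coprime //; move: d; rewrite dvdzE => -> //.
(* The cleared denominator is 1 modulo p, so replacing it by 1 in the p^3 term costs only a multiple
   of p^4. *)
have [a Aa] : exists a, A = 1 + p%:Z * a.
  apply: (intr_Fp_eq p p_prime).
  rewrite /A rmorphM /= fermat; last exact: (pow2_neq0 3).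
  have [D0 _] := den_factors_Fp_coef p p_prime p_gt4.
  rewrite mul1r; transitivity (den_factors {poly 'F_p} p 'X).[0]; last first.
    by rewrite horner_coef0 D0.
  have := rmorph_den_factors _ _ (horner_eval (0 : 'F_p)) p 'X.
  rewrite /= /horner_eval hornerX => ->.
  by have := rmorph_den_factors _ _ (intr : {rmorphism int -> 'F_p}) p 0; rewrite rmorph0.
(* As 4^(p-1) = 16 * 4^(p-3), this is where the coefficient 1/16 comes from. *)
have [b Bb] : exists b : int, 4 ^+ p.-1 = 1 + p%:Z * b.
  by apply: (intr_Fp_eq p p_prime); rewrite fermat //; exact: (pow2_neq0 2).
have ndvdA : ~~ (p %| A)%Z.
  rewrite -intr_Fp_eq0 // Aa rmorphD rmorphM /= -pmulrn.
  by rewrite (pcharf0 (pchar_Fp p_prime)) mul0r addr0 oner_eq0.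
have pA : coprimez p A by rewrite coprimezE prime_coprime //; rewrite dvdzE in ndvdA.
have A0 : A%:~R != 0 :> rat.
  by rewrite intr_eq0; apply: contraNneq ndvdA => ->; exact: dvdz0.
have SA : S = (num_sum int p 0)%:~R / A%:~R.
  have := num_sum0 rat p (prime_gt0 p_prime); rewrite -/S.
  have := rmorph_num_sum _ _ (intr : {rmorphism int -> rat}) p 0.
  have := rmorph_den_factors _ _ (intr : {rmorphism int -> rat}) p 0.
  rewrite /= !rmorph0 => d n; rewrite -n -d => e.
  by apply: (canRL (mulfK A0)); rewrite e /A rmorphM rmorphXn /=; ring.
clearbody A.
(* S exceeds p times the Legendre symbol by p^3 (T + p x) / A. Inserting T = (1 + p b) E / 16 - p c
   and A = 1 + p a, then subtracting p^3 E / 16, leaves p^4 times this witness. *)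
exists (((b%:~R - a%:~R) * E - 16 * (c - x%:~R)) * (2 ^- 4 * A%:~R^-1)).
  have pI y : plocal p y%:~R := plocal_int p y.
  apply: plocalM => //; last first.
    apply: plocalM => //; first exact: (plocal_pow2V p p_prime p_gt2 4).
    exact: plocalV.
  apply: plocalD => //.
    apply: plocalM => //; first by rewrite -rmorphB; exact: pI.
    apply: plocal_euler => //; rewrite mul1r; exact: (plocal_pow2V p p_prime p_gt2 2).
  apply/plocalN/plocalM => //; first exact: (pI 16).
  by apply: plocalD => //; apply: plocalN.
have Tq : T%:~R = 4 ^+ (p - 3) * E - p%:R * c :> rat by rewrite Tc; ring.
have b4 : 16 * 4 ^+ (p - 3) = 1 + p%:R * b%:~R :> rat.
  have := congr1 (fun z : int => z%:~R : rat) Bb.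
  rewrite rmorphXn [in RHS]intrD [in RHS]intrM => <-.
  have -> : p.-1 = (2 + (p - 3))%N by lia.
  by rewrite exprD; congr (_ * _); ring.
have aq : A%:~R = 1 + p%:R * a%:~R :> rat by rewrite Aa rmorphD rmorphM.
have -> : 2 ^- 4 = 16^-1 :> rat by [].
rewrite SA N0 !(rmorphD, rmorphM, rmorphXn) /= -/T Tq -!pmulrn.
have -> : 4 ^+ (p - 3) = (1 + p%:R * b%:~R) / 16 :> rat by rewrite -b4; field.
have -> : a%:~R = (A%:~R - 1) / p%:R :> rat.
  by rewrite aq; field; rewrite pnatr_eq0; lia.
by field; rewrite A0 pnatr_eq0; lia.
Qed.
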